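(* Let $(S,\cdot)$ be an infinite discrete Ramsey semigroup with identity $e$, and let $H$ be a finite group of automorphisms of $(S,\cdot)$ with $\#H=c$. Let $S^H=\{s^H:s\in S\}$, where $s^H=\{\alpha(s):\alpha\in H\}$, with the discrete topology, and define $\delta_{s^H}*\delta_{t^H}=\frac1c\sum_{\alpha\in H}\delta_{(\alpha(s)\cdot t)^H}$ (extended bilinearly). Then $(S^H,* )$ is a discrete semiconvo with identity $e^H$, and it is a recurrent ($0$-Ramsey) semiconvo.
   Context: For a semigroup $S$ and a sequence $\langle x_n\rangle$ in $S$, $\mathrm{FP}(\langle x_n\rangle)=\{x_{n_1}x_{n_2}\cdots x_{n_k}: k\ge1,\ n_1<n_2<\dots<n_k\}$. An infinite semigroup $S$ is a Ramsey semigroup if for every finite partition (colouring) of $S$ there is an injective sequence $\langle x_n\rangle$ in $S$ with $\mathrm{FP}(\langle x_n\rangle)$ contained in a single cell. A discrete semiconvo is a set $K$ with a map assigning to $m,n\in K$ a finitely supported probability measure $\delta_m*\delta_n$ (extended bilinearly), associative, with an identity $e_K$ ($\delta_m*\delta_{e_K}=\delta_{e_K}*\delta_m=\delta_m$). For an injective sequence $\langle x_n\rangle$ in $K\setminus\{e_K\}$ with range $B$ and nonempty finite $F=\{x_{n_1},\dots,x_{n_m}\}\subset B$ with $n_1<\dots<n_m$, $\delta_F=\delta_{x_{n_1}}*\cdots*\delta_{x_{n_m}}$. An infinite discrete semiconvo $K$ is recurrent ($0$-Ramsey) if for every finite partition $K=\bigcup_{i=1}^rC_i$ there exist $i$ and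 an injective sequence $\langle x_n\rangle$ in $K\setminus\{e_K\}$ with range $B$ such that $\delta_F(C_i)>0$ for every nonempty finite $F\subset B$. *)

(* Defs.v *)
From mathcomp Require Import all_boot all_order all_algebra.
From mathcomp Require Import boolp classical_sets functions cardinality fsbigop reals.

Set Implicit Arguments.
Unset Strict Implicit.
Unset Printing Implicit Defensive.

Import Order.TTheory GRing.Theory Num.Theory.

Local Open Scope classical_set_scope.
Local Open Scope ring_scope.

(* In FP and in delta_set the index list n :: s with path ltn n s stands for
   indices n = n_1 < n_2 < ... < n_k, k >= 1. *)

Definition FP (S : semigroupType) (x : nat -> S) : set S :=
  [set y | exists (n : nat) (s : seq nat),
     path ltn n s /\ y = foldl (fun p k => p * x k)%g (x n) s].

Definition ramsey_semigroup (S : semigroupType) : Prop :=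
  infinite_set [set: S] /\
  forall (r : nat) (C : 'I_r -> set S), partition [set: 'I_r] C [set: S] ->
    exists (i : 'I_r) (x : nat -> S), injective x /\ FP x `<=` C i.

(* A finitely supported measure on a discrete space K is encoded by its mass
   function K -> R, so that the measure of A is \sum_(z \in A) mu z. Sums over
   i \in A are 0 by convention when the support is infinite; this does not
   occur for finitely supported mu, nu with finitely supported conv m n. *)
Section Semiconvo.
Variables (R : realType) (K : choiceType).
Implicit Types (mu nu rho : K -> R) (conv : K -> K -> K -> R).

Definition finitely_supported mu : Prop := finite_set [set z | mu z != 0].

Definition measure_of mu (A : set K) : R := \sum_(z \in A) mu z.

Definition finitely_supported_probability mu : Prop :=
  [/\ finitely_supported mu, forall z, 0 <= mu z & measure_of mu [set: K] = 1].

Definition dirac_mass (m : K) : K -> R := fun z => (z == m)%:R.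

Definition convolution conv mu nu : K -> R := fun z =>
  \sum_(m \in [set: K]) \sum_(n \in [set: K]) mu m * nu n * conv m n z.

Definition is_discrete_semiconvo conv (e : K) : Prop :=
  [/\ forall m n, finitely_supported_probability (conv m n),
      forall mu nu rho, finitely_supported mu -> finitely_supported nu ->
        finitely_supported rho ->
        convolution conv mu (convolution conv nu rho) =
        convolution conv (convolution conv mu nu) rho
    & forall m, conv m e = dirac_mass m /\ conv e m = dirac_mass m].

Definition delta_set conv (x : nat -> K) (n : nat) (s : seq nat) : K -> R :=
  foldl (fun mu k => convolution conv mu (dirac_mass (x k)))
        (dirac_mass (x n)) s.

Definition recurrent_semiconvo conv (e : K) : Prop :=
  [/\ infinite_set [set: K], is_discrete_semiconvo conv e
    & forall (r : nat) (C : 'I_r -> set K), partition [set: 'I_r] C [set: K] ->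
        exists (i : 'I_r) (x : nat -> K),
          [/\ injective x, forall n, x n != e
            & forall (n : nat) (s : seq nat), path ltn n s ->
                0 < measure_of (delta_set conv x n s) (C i)]].

End Semiconvo.

Definition is_automorphism (S : semigroupType) (f : S -> S) : Prop :=
  bijective f /\ {morph f : s t / (s * t)%g}.

Definition is_automorphism_group (S : semigroupType) (H : set (S -> S)) : Prop :=
  [/\ forall f, H f -> is_automorphism f,
      H id,
      forall f g, H f -> H g -> H (f \o g)
    & forall f, H f -> exists g, [/\ H g, cancel f g & cancel g f]].

Section OrbitSpace.
Variables (S : semigroupType) (H : set (S -> S)).

Definition orbit_set (s : S) : set S := [set alpha s | alpha in H].

Definition orbit_space : choiceType := set_type (range orbit_set).

Definition orbit_class (s : S) : orbit_space :=
  exist _ (orbit_set s) (mem_set (imageT orbit_set s)).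

(* Only the values on classes of representatives are prescribed; that such a
   conv exists is the independence of the choice of representatives. *)
Definition is_orbit_convolution (R : realType) (c : nat)
    (conv : orbit_space -> orbit_space -> orbit_space -> R) : Prop :=
  forall (s t : S) (z : orbit_space),
    conv (orbit_class s) (orbit_class t) z =
    c%:R^-1 * \sum_(alpha \in H) dirac_mass R (orbit_class (alpha s * t)%g) z.

End OrbitSpace.

(* Main.v *)
(* A colouring of the orbit space pulls back to a colouring of S. The Ramsey
   property gives an injective sequence whose finite products all have orbits
   in one cell, and since orbits are finite it has a subsequence with distinct
   orbits, none of them that of 1. The term of the iterated orbit convolution
   in which every automorphism is the identity puts positive mass on the orbit
   of the corresponding finite product. *)
Require Import Defs.
From mathcomp Require Import all_boot all_order all_algebra.
From mathcomp Require Import boolp classical_sets functions cardinality fsbigop reals.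

Set Implicit Arguments.
Unset Strict Implicit.
Unset Printing Implicit Defensive.

Import Order.TTheory GRing.Theory Num.Theory.

Local Open Scope classical_set_scope.
Local Open Scope ring_scope.

(** Finiteness is assumed because a sum with infinitely many nonzero terms is 0 by convention, which
    would break the bound. *)
Lemma ler_fsum_term (R : realDomainType) (I : choiceType) (P : set I)
    (F : I -> R) (i : I) :
  finite_set (P `&` [set j | F j != 0]) -> (forall j, P j -> 0 <= F j) ->
  P i -> F i <= \sum_(j \in P) F j.
Proof.
move=> finF F0 Pi; have [->|Fi] := eqVneq (F i) 0; first exact: fsumr_ge0.
have -> : \sum_(j \in P) F j = \sum_(j \in P `&` [set j | F j != 0]) F j.
  rewrite fsbig_supp; apply: eq_fsbigl; apply/seteqP.
  by split=> j /= [Pj /eqP].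
rewrite (fsbigD1 i)//= lerDl; apply: fsumr_ge0 => j [[Pj _] _]; exact: F0.
Qed.

Lemma fsum_neq0 (R : realDomainType) (I : choiceType) (P : set I) (F : I -> R) :
  \sum_(i \in P) F i != 0 -> exists2 i, P i & F i != 0.
Proof. exact: (@fsbigN1 _ _ _ unit I P (fun=> F) tt). Qed.

(** * Integration against finitely supported measures *)

Section Mean.
Variables (R : realType) (K : choiceType).
Implicit Types (mu nu rho f : K -> R) (conv : K -> K -> K -> R) (A : set K).

(** The integral of [f] against [mu]. Convolutions become iterated integrals, so that associativity
    reduces to Fubini and a check on point masses. *)
Definition mean mu f : R := \sum_(m \in [set: K]) mu m * f m.

(** Used to trade the sum over all of [K] for one over a finite set, where sums can be exchanged and
    products distributed. *)
Lemma mean_sub A mu f : [set z | mu z != 0] `<=` A ->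
  mean mu f = \sum_(m \in A) mu m * f m.
Proof.
move=> muA; apply/esym/fsbig_widen => // z [_ Az] /=.
by have [->|/muA//] := eqVneq (mu z) 0; rewrite mul0r.
Qed.

Lemma eq_mean mu f g : f =1 g -> mean mu f = mean mu g.
Proof. by move=> fg; apply: eq_fsbigr => m _; rewrite fg. Qed.

Lemma mean_ge0 mu f :
  (forall z, 0 <= mu z) -> (forall z, 0 <= f z) -> 0 <= mean mu f.
Proof. by move=> mu0 f0; apply: fsumr_ge0 => z _; apply: mulr_ge0. Qed.

Lemma ler_mean_term mu f m : finitely_supported mu ->
  (forall z, 0 <= mu z) -> (forall z, 0 <= f z) -> mu m * f m <= mean mu f.
Proof.
move=> finmu mu0 f0.
apply: (@ler_fsum_term _ _ setT (fun z => mu z * f z)) => // [|z _].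
  apply: sub_finite_set finmu => z [_] /=.
  by apply: contra_neq => ->; rewrite mul0r.
exact: mulr_ge0.
Qed.

Lemma dirac_mass_neq0 (m z : K) : (dirac_mass R m z != 0) = (z == m).
Proof. by rewrite pnatr_eq0 eqb0 negbK. Qed.

Lemma finitely_supported_dirac (m : K) : finitely_supported (dirac_mass R m).
Proof.
by apply: (@sub_finite_set _ _ [set m]) => // z /=; rewrite dirac_mass_neq0 => /eqP.
Qed.

Lemma mean_dirac (m : K) f : mean (dirac_mass R m) f = f m.
Proof.
rewrite (@mean_sub [set m]).
  by rewrite fsbig_set1 /dirac_mass eqxx mul1r.
by move=> z /=; rewrite dirac_mass_neq0 => /eqP.
Qed.

Lemma exchange_mean mu nu (F : K -> K -> R) :
  finitely_supported mu -> finitely_supported nu ->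
  mean mu (fun m => mean nu (F m)) = mean nu (fun n => mean mu (F^~ n)).
Proof.
move=> finmu finnu.
rewrite (mean_sub _ (@subset_refl _ _)) [RHS](mean_sub _ (@subset_refl _ _)).
under eq_fsbigr do rewrite (mean_sub _ (@subset_refl _ _)) mulr_fsumr.
under [RHS]eq_fsbigr do rewrite (mean_sub _ (@subset_refl _ _)) mulr_fsumr.
rewrite exchange_fsbig//; apply: eq_fsbigr => n _; apply: eq_fsbigr => m _.
by rewrite mulrCA.
Qed.

Lemma convolution_mean conv mu nu z :
  convolution conv mu nu z = mean mu (fun m => mean nu (fun n => conv m n z)).
Proof.
apply: eq_fsbigr => m _; rewrite mulr_fsumr.
by apply: eq_fsbigr => n _; rewrite mulrA.
Qed.

Section FiniteConv.
Variable conv : K -> K -> K -> R.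
Hypothesis finconv : forall m n, finitely_supported (conv m n).

(** Contains the support of the convolution and also that of [conv m n] for all [m], [n] charged by
    [mu], [nu]; one index set thus serves both sides of [mean_convolution]. *)
Let spt mu nu : set K :=
  \bigcup_(m in [set m | mu m != 0]) \bigcup_(n in [set n | nu n != 0])
    [set z | conv m n z != 0].

Let finite_spt mu nu :
  finitely_supported mu -> finitely_supported nu -> finite_set (spt mu nu).
Proof.
move=> finmu finnu; apply: bigcup_finite => [|m _]; first exact: finmu.
by apply: bigcup_finite => [|n _]; [exact: finnu|exact: finconv].
Qed.

Let sub_spt mu nu : [set z | convolution conv mu nu z != 0] `<=` spt mu nu.
Proof.
move=> z /= /fsum_neq0[m _] /fsum_neq0[n _].
by rewrite !mulf_eq0 !negb_or => /andP[/andP[mum nun] cz]; exists m => //; exists n.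
Qed.

Lemma finitely_supported_convolution mu nu :
  finitely_supported mu -> finitely_supported nu ->
  finitely_supported (convolution conv mu nu).
Proof.
by move=> finmu finnu; apply: sub_finite_set (@sub_spt _ _) (finite_spt _ _).
Qed.

Lemma mean_convolution mu nu f :
  finitely_supported mu -> finitely_supported nu ->
  mean (convolution conv mu nu) f =
  mean mu (fun m => mean nu (fun n => mean (conv m n) f)).
Proof.
move=> finmu finnu; have finA := finite_spt finmu finnu.
rewrite (mean_sub _ (@sub_spt mu nu)) [RHS](mean_sub _ (@subset_refl _ _)).
(* Both sides are compared with one triple sum over finite sets, in which the summation over [z] is
   then moved innermost. *)
transitivity (\sum_(z \in spt mu nu) \sum_(m \in [set m | mu m != 0])
    \sum_(n \in [set n | nu n != 0]) mu m * (nu n * (conv m n z * f z))).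
  apply: eq_fsbigr => z _.
  rewrite convolution_mean (mean_sub _ (@subset_refl _ _)) mulr_fsuml.
  apply: eq_fsbigr => m _.
  rewrite (mean_sub _ (@subset_refl _ _)) -mulrA mulr_fsuml mulr_fsumr.
  by apply: eq_fsbigr => n _; rewrite -mulrA.
rewrite exchange_fsbig//; apply: eq_fsbigr => m; rewrite inE /= => mum.
rewrite exchange_fsbig// (mean_sub _ (@subset_refl _ _)) mulr_fsumr.
apply: eq_fsbigr => n; rewrite inE /= => nun.
rewrite (@mean_sub (spt mu nu)); first by rewrite !mulr_fsumr.
by move=> z cz; exists m => //; exists n.
Qed.

(** Both sides unfold to triple integrals against [mu], [nu], [rho], whose integrands agree by
    associativity on point masses. *)
Lemma convolution_assoc :
  (forall a b c z, mean (conv a b) (fun k => conv k c z) =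
                   mean (conv b c) (fun k => conv a k z)) ->
  forall mu nu rho, finitely_supported mu -> finitely_supported nu ->
    finitely_supported rho ->
    convolution conv mu (convolution conv nu rho) =
    convolution conv (convolution conv mu nu) rho.
Proof.
move=> convA mu nu rho finmu finnu finrho; apply: funext => z.
rewrite !convolution_mean mean_convolution//; apply: eq_mean => m.
rewrite mean_convolution//; apply: eq_mean => n.
(* On the right [rho] is integrated inside [conv m n]; it has to be brought outside to match the
   left. *)
by rewrite exchange_mean//; apply: eq_mean => p; rewrite convA.
Qed.

End FiniteConv.
End Mean.

(** * Extraction of subsequences *)

Lemma strictly_increasing_seq (P : nat -> nat -> Prop) :
  (forall N, exists M, forall i j, (i <= N)%N -> (M <= j)%N -> P i j) ->
  forall M0, exists phi : nat -> nat,
    [/\ {homo phi : m n / (m < n)%N}, forall n, (M0 <= phi n)%N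
      & forall m n, (m < n)%N -> P (phi m) (phi n)].
Proof.
move=> /choice[g gP] M0.
(* The threshold [g (phi k)] is valid for every index up to [phi k], hence for all earlier terms at
   once; [(phi k).+1] forces strict growth. *)
pose phi := fix phi n := if n is k.+1 then maxn (g (phi k)) (phi k).+1 else M0.
have phiS : {homo phi : m n / (m < n)%N}.
  by apply: homo_ltn => [? ? ?|n]; [exact: ltn_trans|rewrite /= leq_maxr].
exists phi; split=> // [n|m n mn].
  by elim: n => [|n IH] //=; rewrite (leq_trans IH)// (leq_trans _ (leq_maxr _ _)).
case: n mn => // n; rewrite ltnS => mn; apply: gP; last exact: leq_maxl.
by move: mn; rewrite leq_eqVlt => /predU1P[->//|/phiS/ltnW].
Qed.

(** Start after the last occurrence of [e], then always move past the last occurrence of any value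
    met so far. Monotonicity of [phi] is kept so that products along the subsequence stay in
    increasing order of index. *)
Lemma finite_to_one_subseq (T : Type) (x : nat -> T) (e : T) :
  (forall y, finite_set [set n | x n = y]) ->
  exists phi : nat -> nat, [/\ {homo phi : m n / (m < n)%N},
    injective (x \o phi) & forall n, x (phi n) <> e].
Proof.
move=> finx.
have bound (A : set nat) : finite_set A ->
    exists M, forall j, (M <= j)%N -> ~ A j.
  move=> /finite_fsetP[X ->]; exists (\max_(i <- finmap.enum_fset X) i).+1.
  move=> j Mj /= jX; move: Mj; rewrite ltnNge => /negP; apply.
  by apply: (@leq_bigmax_seq _ _ xpredT id).
have [M0 M0P] := bound _ (finx e).
have [N|phi [phiS phiM phiP]] :=
    @strictly_increasing_seq (fun i j => x i <> x j) _ M0.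
  have finA : finite_set (\bigcup_(i in `I_N.+1) [set j | x j = x i]).
    exact: bigcup_finite.
  have [M MP] := bound _ finA; exists M => i j iN Mj xij.
  by apply: (MP j Mj); exists i => //=; rewrite ltnS.
exists phi; split=> // [m n /= mn|n]; last exact: M0P.
by have [/phiP//|/phiP/nesym//|//] := ltngtP m n.
Qed.

(** * Orbits of a finite automorphism group *)

Section Orbit.
Variables (R : realType) (S : monoidType) (H : set (S -> S)) (c : nat).
Hypothesis autH : is_automorphism_group H.
Hypothesis cardH : (H #= `I_c)%card.

Local Notation cl := (orbit_class H).

Let finH : finite_set H. Proof. by exists c. Qed.
Let Hid : H id. Proof. by case: autH. Qed.
Let HM f g : H f -> H g -> H (f \o g). Proof. by case: autH => _ _ + _; apply. Qed.
Let HV f : H f -> exists g, [/\ H g, cancel f g & cancel g f].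
Proof. by case: autH => _ _ _; apply. Qed.
Let Hmul f : H f -> {morph f : s t / (s * t)%g}.
Proof. by case: autH => + _ _ _ => /[apply] -[]. Qed.

(** Automorphisms are only required to preserve products; surjectivity does the rest, as
    [f 1 = f 1 * f (g 1) = f (1 * g 1) = 1]. *)
Lemma automorphism1 f : H f -> f 1%g = 1%g.
Proof.
move=> Hf; have [g [_ _ gK]] := HV Hf.
by rewrite -[LHS]monoid.mulg1 -{2}(gK 1%g) -(Hmul Hf) monoid.mul1g gK.
Qed.

Lemma orbit_class_eqP s t : cl s = cl t <-> exists2 f, H f & f s = t.
Proof.
split=> [[st]|[f Hf <-]].
  have : orbit_set H t t by exists id.
  by rewrite -st => -[f Hf <-]; exists f.
apply: eq_exist; apply/seteqP; split=> u [g Hg <-].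
  have [h [Hh fK _]] := HV Hf; exists (g \o h); first exact: HM.
  by rewrite /= fK.
by exists (g \o f) => //; exact: HM.
Qed.

Lemma orbit_classP (z : orbit_space H) : exists s, cl s = z.
Proof.
case: z => A Az; have [s _ sA] := set_mem Az.
by exists s; apply: eq_exist.
Qed.

Lemma finite_orbit_class z : finite_set [set s | cl s = z].
Proof.
have [t <-] := orbit_classP z.
apply: (@sub_finite_set _ _ [set f t | f in H]); last exact: finite_image.
by move=> s /= /esym /orbit_class_eqP[f Hf fs]; exists f.
Qed.

(** Left translation by [g] permutes the group, with inverse the translation by [g^-1]. *)
Lemma fsum_compl g (F : (S -> S) -> R) : H g ->
  \sum_(f \in H) F (g \o f) = \sum_(f \in H) F f.
Proof.
move=> Hg; have [h [Hh gK hK]] := HV Hg.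
rewrite [RHS](@reindex_fsbig _ _ _ _ _ (fun f : S -> S => g \o f) H H)//; split.
- by move=> f Hf; exact: HM.
- move=> f1 f2 _ _ /= e; apply: funext => s.
  by apply: (can_inj gK); have := congr1 (@^~ s) e.
- move=> f Hf; exists (h \o f); first exact: HM.
  by apply: funext => s /=; rewrite hK.
Qed.

Lemma fsum_compr g (F : (S -> S) -> R) : H g ->
  \sum_(f \in H) F (f \o g) = \sum_(f \in H) F f.
Proof.
move=> Hg; have [h [Hh gK hK]] := HV Hg.
rewrite [RHS](@reindex_fsbig _ _ _ _ _ (fun f : S -> S => f \o g) H H)//; split.
- by move=> f Hf; exact: HM.
- move=> f1 f2 _ _ /= e; apply: funext => s.
  by have := congr1 (@^~ (h s)) e; rewrite /= hK.
- move=> f Hf; exists (f \o h); first exact: HM.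
  by apply: funext => s /=; rewrite gK.
Qed.

Lemma group_order_gt0 : (0 < c)%N.
Proof.
case: c cardH => //; rewrite II0 card_eq0 => /eqP H0.
by have := Hid; rewrite H0.
Qed.

Lemma fsum_group_1 : \sum_(f \in H) (1 : R) = c%:R.
Proof.
have [h hbij] := card_set_bijP cardH.
by rewrite -(reindex_fsbig h _ _ (fun=> 1) hbij) -fsbig_ord sumr_const card_ord.
Qed.

(** Independence of representatives. Replacing [s] by [b s] is absorbed by a right translation of
    the group. Replacing [t] by [g t] is absorbed by a left one, since [g (f s) * g t = g (f s * t)]
    lies in the orbit of [f s * t]. *)
Lemma orbit_sum_respects (phi : orbit_space H -> R) s t s' t' :
  cl s = cl s' -> cl t = cl t' ->
  \sum_(f \in H) phi (cl (f s * t)%g) = \sum_(f \in H) phi (cl (f s' * t')%g).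
Proof.
move=> /orbit_class_eqP[b Hb <-] /orbit_class_eqP[g Hg <-].
rewrite (fsum_compr (fun f => phi (cl (f s * g t)%g)) Hb).
rewrite -(fsum_compl (fun f => phi (cl (f s * g t)%g)) Hg).
apply: eq_fsbigr => f _; congr phi; apply/orbit_class_eqP.
by exists g; rewrite // Hmul.
Qed.

Lemma orbit_convolution_unique :
  exists! conv : orbit_space H -> orbit_space H -> orbit_space H -> R,
    is_orbit_convolution c conv.
Proof.
have [rep repP] := choice orbit_classP.
exists (fun a b z => c%:R^-1 *
  \sum_(f \in H) dirac_mass R (cl (f (rep a) * rep b)%g) z).
split=> [s t z|conv convP].
  by congr (_ * _); apply: (orbit_sum_respects (fun k => dirac_mass R k z)).
by apply: funext => a; apply: funext => b; apply: funext => z;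
  rewrite -convP !repP.
Qed.

(** * Semiconvo axioms for the orbit convolution *)

Variable conv : orbit_space H -> orbit_space H -> orbit_space H -> R.
Hypothesis convP : is_orbit_convolution c conv.

Lemma orbit_conv_support s t :
  [set z | conv (cl s) (cl t) z != 0] `<=` [set cl (f s * t)%g | f in H].
Proof.
move=> z /=; rewrite convP mulf_eq0 negb_or => /andP[_] /fsum_neq0[f Hf].
by rewrite dirac_mass_neq0 => /eqP ->; exists f.
Qed.

Lemma finitely_supported_orbit_conv a b : finitely_supported (conv a b).
Proof.
have [s <-] := orbit_classP a; have [t <-] := orbit_classP b.
by apply: sub_finite_set (@orbit_conv_support s t) (finite_image _ _).
Qed.

(** The measure is an average of point masses, and integrating against a point mass is
    evaluation. *)
Lemma mean_orbit_conv s t phi : mean (conv (cl s) (cl t)) phi =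
  c%:R^-1 * \sum_(f \in H) phi (cl (f s * t)%g).
Proof.
rewrite (mean_sub _ (@orbit_conv_support s t)).
under eq_fsbigr do rewrite convP -mulrA mulr_fsuml.
rewrite -mulr_fsumr exchange_fsbig//; last exact: finite_image.
congr (_ * _); apply: eq_fsbigr => f; rewrite inE => Hf.
rewrite -mean_sub ?mean_dirac// => z /=.
by rewrite dirac_mass_neq0 => /eqP ->; exists f.
Qed.

Lemma orbit_conv_ge0 a b z : 0 <= conv a b z.
Proof.
have [s <-] := orbit_classP a; have [t <-] := orbit_classP b.
rewrite convP mulr_ge0 ?invr_ge0 ?ler0n//.
by apply: fsumr_ge0 => f _; rewrite ler0n.
Qed.

Lemma orbit_conv_mul_gt0 s t : 0 < conv (cl s) (cl t) (cl (s * t)%g).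
Proof.
rewrite convP mulr_gt0 ?invr_gt0 ?ltr0n ?group_order_gt0//.
apply: (@lt_le_trans _ _ (dirac_mass R (cl (s * t)%g) (cl (s * t)%g))).
  by rewrite /dirac_mass eqxx ltr01.
apply: (@ler_fsum_term _ _ H
  (fun f : S -> S => dirac_mass R (cl (f s * t)%g) _) id) => //.
exact: finite_setIl.
Qed.

Lemma orbit_convA a b d z :
  mean (conv a b) (fun k => conv k d z) = mean (conv b d) (fun k => conv a k z).
Proof.
have [r <-] := orbit_classP a; have [s <-] := orbit_classP b.
have [t <-] := orbit_classP d.
rewrite !mean_orbit_conv; congr (_ * _).
under eq_fsbigr do rewrite convP.
under [RHS]eq_fsbigr do rewrite convP.
rewrite -!mulr_fsumr exchange_fsbig//; congr (_ * _).
(* f (g r * s) * t = (f \o g) r * (f s * t); reindex g for fixed f *)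
under [LHS]eq_fsbigr => f /set_mem Hf.
  under eq_fsbigr => g _ do rewrite (Hmul Hf) -monoid.mulgA.
  rewrite (fsum_compl (fun g => dirac_mass R (cl (g r * (f s * t))%g) z) Hf).
  over.
by [].
Qed.

Lemma is_discrete_semiconvo_orbit : is_discrete_semiconvo conv (cl 1%g).
Proof.
have cc : c%:R^-1 * c%:R = 1 :> R.
  by rewrite mulVf// pnatr_eq0 -lt0n group_order_gt0.
split=> [a b||a].
- split; [exact: finitely_supported_orbit_conv|exact: orbit_conv_ge0|].
  have -> : measure_of (conv a b) setT = mean (conv a b) (fun=> 1).
    by apply: eq_fsbigr => z _; rewrite mulr1.
  have [s <-] := orbit_classP a; have [t <-] := orbit_classP b.
  by rewrite mean_orbit_conv fsum_group_1 cc.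
- exact: convolution_assoc finitely_supported_orbit_conv orbit_convA.
- have [s <-] := orbit_classP a; split; apply: funext => z; rewrite convP.
    rewrite (eq_fsbigr (fun=> dirac_mass R (cl s) z * 1)).
      by rewrite -mulr_fsumr fsum_group_1 mulrCA cc mulr1.
    move=> f /set_mem Hf; rewrite monoid.mulg1 mulr1.
    by congr dirac_mass; apply/esym/orbit_class_eqP; exists f.
  rewrite (eq_fsbigr (fun=> dirac_mass R (cl s) z * 1)).
    by rewrite -mulr_fsumr fsum_group_1 mulrCA cc mulr1.
  by move=> f /set_mem Hf; rewrite automorphism1// monoid.mul1g mulr1.
Qed.

(** * Recurrence *)

Lemma delta_set_orbit (x : nat -> S) n s :
  let mu := delta_set conv (cl \o x) n s in
  [/\ finitely_supported mu, forall z, 0 <= mu z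
    & 0 < mu (cl (foldl (fun p k => p * x k)%g (x n) s))].
Proof.
(* The invariant is stated for an arbitrary measure and product, since both accumulators change
   along the fold. Finite support and nonnegativity belong to it because they let a single term
   bound the next integral from below. *)
rewrite /=; pose charges (mu : orbit_space H -> R) p :=
  [/\ finitely_supported mu, forall z, 0 <= mu z & 0 < mu (cl p)].
suff charges_fold mu p : charges mu p ->
    charges (foldl (fun mu k => convolution conv mu (dirac_mass R (cl (x k)))) mu s)
            (foldl (fun p k => p * x k)%g p s).
  apply: charges_fold; split; [exact: finitely_supported_dirac| |].
    by move=> z; exact: ler0n.
  by rewrite /dirac_mass eqxx ltr01.
elim: s mu p => //= k s IH mu p [finmu mu0 mup].
have convk z : convolution conv mu (dirac_mass R (cl (x k))) z =
    mean mu (fun m => conv m (cl (x k)) z).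
  by rewrite convolution_mean; apply: eq_mean => m; rewrite mean_dirac.
apply: IH; split.
- apply: finitely_supported_convolution => //.
    exact: finitely_supported_orbit_conv.
  exact: finitely_supported_dirac.
- move=> z; rewrite convk; apply: mean_ge0 => // m; exact: orbit_conv_ge0.
- rewrite convk; apply: lt_le_trans (ler_mean_term (cl p) finmu mu0 _).
    by rewrite mulr_gt0// orbit_conv_mul_gt0.
  by move=> m; exact: orbit_conv_ge0.
Qed.

(** Otherwise [S] would be a finite union of finite orbits. *)
Lemma infinite_orbit_space :
  infinite_set [set: S] -> infinite_set [set: orbit_space H].
Proof.
move=> infS finK; apply: infS.
apply: (@sub_finite_set _ _ (\bigcup_(z in [set: orbit_space H]) [set s | cl s = z])).
  by move=> s _; exists (cl s).
by apply: bigcup_finite => // z _; exact: finite_orbit_class.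
Qed.

Lemma recurrent_semiconvo_orbit :
  ramsey_semigroup S -> recurrent_semiconvo conv (cl 1%g).
Proof.
case=> infS ramS.
split; [exact: infinite_orbit_space|exact: is_discrete_semiconvo_orbit|].
move=> r C [CT Ctriv Cne].
have [|i [x [xinj xC]]] := ramS r (fun i => cl @^-1` C i).
  (* The preimages of the cells partition [S]; they are nonempty because every orbit has a
     representative. *)
  split=> [|i j Di Dj [s [Cis Cjs]]|i Di].
  - apply/seteqP; split=> // s _; have : [set: orbit_space H] (cl s) by [].
    by rewrite -CT => -[i _ Cis]; exists i.
  - by apply: Ctriv => //; exists (cl s).
  - by have [z Cz] := Cne i Di; have [s sz] := orbit_classP z; exists s; rewrite /= sz.
have [|phi [phiS phiinj phie]] := @finite_to_one_subseq _ (cl \o x) (cl 1%g).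
  move=> z; apply: (@finite_preimage _ _ [set s | cl s = z] x).
    by move=> m n _ _; exact: xinj.
  exact: finite_orbit_class.
exists i, (cl \o (x \o phi)); split=> // [n|n s ns]; first by apply/eqP/phie.
have [fin_mu mu0 mup] := delta_set_orbit (x \o phi) n s.
apply: (lt_le_trans mup); apply: ler_fsum_term => //.
  by apply: sub_finite_set fin_mu => z [].
(* As [phi] is strictly increasing, [map phi s] is again an increasing list of indices, so the
   product along [x \o phi] belongs to [FP x]. *)
apply: xC; exists (phi n), (map phi s); split.
  by rewrite path_map; apply: sub_path ns.
by rewrite /=; elim: s {ns mup mu0 fin_mu} (x (phi n)) => /=.
Qed.

End Orbit.

Theorem theorem4p11 (R : realType) (S : monoidType) (H : set (S -> S)) (c : nat)
    (ramseyS : ramsey_semigroup S)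
    (autH : is_automorphism_group H)
    (cardH : (H #= `I_c)%card) :
  (exists! conv : orbit_space H -> orbit_space H -> orbit_space H -> R,
     is_orbit_convolution c conv) /\
  (forall conv : orbit_space H -> orbit_space H -> orbit_space H -> R,
     is_orbit_convolution c conv ->
     is_discrete_semiconvo conv (orbit_class H 1%g) /\
     recurrent_semiconvo conv (orbit_class H 1%g)).
Proof.
split=> [|conv convP]; first exact: orbit_convolution_unique.
split; first exact: is_discrete_semiconvo_orbit autH cardH _ convP.
exact: recurrent_semiconvo_orbit autH cardH _ convP ramseyS.
Qed.
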